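(* Let $\mathsf{q} \geq 2$ and let $\lambda_1,\dots,\lambda_\ell$ be the iterates produced by the subspace method with reduced functions $R^{\mathcal{W}_\ell,\mathcal{V}_\ell}(\cdot)$ satisfying the interpolation properties $R(\lambda_k) = R^{\mathcal{W}_\ell,\mathcal{V}_\ell}(\lambda_k)$ and $R^{(j)}(\lambda_k) = [R^{\mathcal{W}_\ell,\mathcal{V}_\ell}]^{(j)}(\lambda_k)$ for $j=1,\dots,2\mathsf{q}-1$, $k=1,\dots,\ell$. Then for $k=1,\dots,\ell$ and $j=1,\dots,\mathsf{n}$: (i) $\eta_j(\lambda_k) = \eta^{\mathcal{W}_\ell,\mathcal{V}_\ell}_j(\lambda_k)$; (ii) if $\eta_j(\lambda_k)$ is a simple eigenvalue of $M(\lambda_k)$, then $\eta^{\mathcal{W}_\ell,\mathcal{V}_\ell}_j(\lambda_k)$ is a simple eigenvalue of $M^{\mathcal{W}_\ell,\mathcal{V}_\ell}(\lambda_k)$, and in this case $\eta_j'(\lambda_k) = [\eta^{\mathcal{W}_\ell,\mathcal{V}_\ell}_j]'(\lambda_k)$ and $\nabla^2\eta_j(\lambda_k) = \nabla^2\eta^{\mathcal{W}_\ell,\mathcal{V}_\ell}_j(\lambda_k)$.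
   Context: Let $R(s) = P(s) + C(sI_{\mathsf{k}} - A)^{-1}B$ be a rational matrix-valued function of size $\mathsf{n}\times\mathsf{n}$, with $P(s)=\sum_{i=0}^{\mathsf{d}} s^i P_i$, $A\in\mathbb{C}^{\mathsf{k}\times\mathsf{k}}$, $B\in\mathbb{C}^{\mathsf{k}\times\mathsf{n}}$, $C\in\mathbb{C}^{\mathsf{n}\times\mathsf{k}}$. For subspaces $\mathcal{W},\mathcal{V}\subseteq\mathbb{C}^{\mathsf{k}}$ of equal dimension with orthonormal basis matrices $W,V$, the reduced function is $R^{\mathcal{W},\mathcal{V}}(s) = P(s) + CV(sW^*V - W^*AV)^{-1}W^*B$. The subspace method (Algorithm 1) starts at $\lambda_0=\tau$ (a target point) and at each iteration $\ell$ expands $\mathcal{V}_{\ell-1},\mathcal{W}_{\ell-1}$ by the ranges of $(A-\lambda_\ell I)^{-i}B$ and $((A-\lambda_\ell I)^{-i})^* C^*$ for $i=1,\dots,\mathsf{q}$, orthonormalizes to get $V_\ell, W_\ell$, and takes $\lambda_{\ell+1}$ as the eigenvalue of the reduced problem closest to $\tau$; this yields the interpolation properties stated in the claim. Define $M(s) := R(s)^*R(s)$ and $M^{\mathcal{W}_\ell,\mathcal{V}_\ell}(s) := R^{\mathcal{W}_\ell,\mathcal{V}_\ell}(s)^* R^{\mathcal{W}_\ell,\mathcal{V}_\ell}(s)$, with eigenvalues $\eta_1(s)\ge\dots\ge\eta_{\mathsf{n}}(s)$ and $\eta^{\mathcal{W}_\ell,\mathcal{V}_\ell}_1(s)\ge\dots\ge\eta^{\mathcal{W}_\ell,\mathcal{V}_\ell}_{\mathsf{n}}(s)$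 (squared singular values of $R(s)$ and $R^{\mathcal{W}_\ell,\mathcal{V}_\ell}(s)$). Here $\eta_j'(s) := [\partial\eta_j(s)/\partial\operatorname{Re}(s),\ \partial\eta_j(s)/\partial\operatorname{Im}(s)]$ and $\nabla^2\eta_j(s)$ is the $2\times 2$ Hessian with respect to $(\operatorname{Re}(s),\operatorname{Im}(s))$; analogously for $\eta^{\mathcal{W}_\ell,\mathcal{V}_\ell}_j$. *)

(* Defs.v *)
From HB Require Import structures.
From mathcomp Require Import all_boot all_order all_algebra.
From mathcomp Require Import all_classical all_reals all_analysis.
From mathcomp Require Import complex.
Set Implicit Arguments. Unset Strict Implicit. Unset Printing Implicit Defensive.
Import Order.TTheory GRing.Theory Num.Theory.
Import numFieldNormedType.Exports.
Local Open Scope ring_scope.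

Section Defs.
Variable R : realType.
Local Notation C := (R[i]).

Definition ctmx m p (A : 'M[C]_(m, p)) : 'M[C]_(p, m) := (map_mx Num.conj A)^T.

Definition Rfun (n k d : nat) (P : 'I_d.+1 -> 'M[C]_n)
    (A : 'M[C]_k) (B : 'M[C]_(k, n)) (Cm : 'M[C]_(n, k)) : C -> 'M[C]_n :=
  fun s => \sum_(i < d.+1) s ^+ i *: P i + Cm *m invmx (s%:M - A) *m B.

Definition Rred (n k d r : nat) (P : 'I_d.+1 -> 'M[C]_n)
    (A : 'M[C]_k) (B : 'M[C]_(k, n)) (Cm : 'M[C]_(n, k))
    (W V : 'M[C]_(k, r)) : C -> 'M[C]_n :=
  fun s => \sum_(i < d.+1) s ^+ i *: P i
           + (Cm *m V) *m invmx (s *: (ctmx W *m V) - ctmx W *m A *m V)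
             *m (ctmx W *m B).

Definition Mof n (F : C -> 'M[C]_n) : C -> 'M[C]_n :=
  fun s => ctmx (F s) *m F s.

Definition eigs_desc n (M : 'M[C]_n) : seq R :=
  xget (nseq n 0) (fun s : seq R => sorted (fun x y : R => y <= x) s /\
         char_poly M = \prod_(x <- s) ('X - (x%:C)%C%:P)).

(* eta_j(M), j = 0..n-1 (0-based: eta 0 is the largest eigenvalue) *)
Definition eigval n (j : 'I_n) (M : 'M[C]_n) : R := nth 0 (eigs_desc M) j.

Definition simple_eig n (x : R) (M : 'M[C]_n) : bool :=
  mup (x%:C)%C (char_poly M) == 1%N.

Definition eta_fun n (j : 'I_n) (F : C -> 'M[C]_n) : R * R -> R :=
  fun p => eigval j (Mof F (Complex p.1 p.2)).

Definition cplx_pt (s : C) : R * R := (complex.Re s, complex.Im s).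

Definition dir (a : 'I_2) : R * R := if val a == 0%N then (1, 0) else (0, 1).

Definition same_grad_hess (g h : R * R -> R) (p : R * R) : Prop :=
  forall a b : 'I_2,
    [/\ derivable g p (dir a), derivable h p (dir a)
      & 'D_(dir a) g p = 'D_(dir a) h p] /\
    [/\ derivable ('D_(dir b) g) p (dir a), derivable ('D_(dir b) h) p (dir a)
      & 'D_(dir a) ('D_(dir b) g) p = 'D_(dir a) ('D_(dir b) h) p].

End Defs.

(* Main.v *)
(* Part (i) and the preservation of simplicity only use F(s) = G(s), where
   F, G are the full and reduced functions and s an interpolation point. For
   the derivatives, write eta = eta_j(x, y) as a root of the characteristic
   polynomial sum_i c_i(x, y) z^i of F^* F at x + iy. Entries of F and G are
   quotients of complex polynomials with equal value, F' and F'' at s, so the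
   c_i for F and for G have the same real 2-jet there. Sorted eigenvalues of
   Hermitian matrices are continuous (Weyl), so a simple eta stays simple
   nearby, and implicit differentiation gives
   D_a eta = - (sum_i (D_a c_i) eta^i) / (sum_i i c_i eta^(i-1)),
   an expression whose value and first derivatives are fixed by the 2-jets. *)
Require Import Defs.
From HB Require Import structures.
From mathcomp Require Import all_boot all_order all_fingroup all_algebra.
From mathcomp Require Import all_classical all_reals all_analysis.
From mathcomp Require Import complex.
From mathcomp Require Import ring zify.
Import Order.TTheory GRing.Theory Num.Theory.
Import numFieldNormedType.Exports.
Set Implicit Arguments.
Unset Strict Implicit.
Unset Printing Implicit Defensive.
Local Open Scope classical_set_scope.
Local Open Scope ring_scope.

(** * Complex derivatives of rational matrix functions *)

Lemma is_derive_horner (K : numFieldType) (p : {poly K}) (x : K) :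
  is_derive x 1 (horner p : K -> K) p^`().[x].
Proof.
elim/poly_ind: p => [|p c IHp].
  rewrite (_ : horner 0 = cst 0) ?deriv0 ?horner0; first exact: is_derive_cst.
  by apply/funext => y; rewrite horner0.
rewrite (_ : horner _ = (horner p : K -> K) * id + cst c); last first.
  by apply/funext => y; rewrite !hornerE.
apply: is_derive_eq; rewrite addr0 derivD derivM derivX derivC !hornerE.
by rewrite [_%:A]mulr1 [x *: _]mulrC addrC.
Qed.

Lemma is_derive_ratio (K : numFieldType) (N D : {poly K}) (x : K) :
  D.[x] != 0 ->
  is_derive x 1 (fun s : K => N.[s] / D.[s] : K)
    ((N^`() * D - N * D^`()).[x] / (D ^+ 2).[x]).
Proof.
move=> Dx.
have [dN eN] := is_derive_horner N x.
have [dD eD] := is_derive_horner D x.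
have dV := derivableV Dx dD.
apply: DeriveDef; first exact: (derivableM dN dV).
rewrite (deriveM dN dV) (deriveV Dx dD) eN eD !hornerE.
rewrite [N.[x] *: _]mulrA [D.[x]^-1 *: _]mulrC.
change (- D.[x] ^- 2 *: D^`().[x]) with (- D.[x] ^- 2 * D^`().[x]).
by field.
Qed.

(** A neighbourhood of a matrix contains a product of neighbourhoods of its entries, and the
    finitely many entrywise limits can be intersected. *)
Lemma derive1_mx_entrywise (K : numFieldType) m n (F : K -> 'M[K]_(m, n))
    (L : 'M[K]_(m, n)) (x : K) :
  (forall i j, is_derive x 1 (fun s => F s i j : K) (L i j)) ->
  derive1 F x = L.
Proof.
move=> dF; apply/cvg_lim; first exact: norm_hausdorff.
move=> A [B nB sBA].
have: \forall h \near ((0 : K)^')%classic, forall ij : 'I_m * 'I_n,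
    B ij.1 ij.2 (h^-1 *: (F (h *: 1 + x) ij.1 ij.2 - F x ij.1 ij.2)).
  apply: filter_forall => -[i j] /=.
  have [dFij eFij] := dF i j.
  move: (nB i j); rewrite -eFij; exact: dFij.
apply: filterS => h Bh; apply: sBA => i j; rewrite !mxE.
by have := Bh (i, j); rewrite [h *: 1]mulr1.
Qed.

Lemma derivable1_continuous (K : numFieldType) (f : K -> K) (x : K) :
  derivable f x 1 -> {for x, continuous f}.
Proof. by move=> df; apply/differentiable_continuous/derivable1_diffP. Qed.

Lemma near_horner_neq0 (K : numFieldType) (p : {poly K}) (x : K) :
  p.[x] != 0 -> \forall s \near x, p.[s] != 0.
Proof.
move=> px; have [dp _] := is_derive_horner p x.
have cp := derivable1_continuous dp.
apply: (cp [set y | y != 0]%classic).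
exists `|p.[x]|; first by rewrite /= normr_gt0.
move=> y /=; apply: contraTneq => ->.
by rewrite subr0 ltxx.
Qed.

(** All entries share one denominator, so a single condition [D.[s] != 0] keeps the whole matrix
    away from its poles. *)
Definition ratmx (K : numFieldType) m n (N : 'M[{poly K}]_(m, n))
    (D : {poly K}) (s : K) : 'M[K]_(m, n) :=
  \matrix_(i, j) ((N i j).[s] / D.[s]).

(** Numerators of the quotient rule over the denominator [D ^+ 2]. The form [ratmx] is thus closed
    under differentiation and the rule can be iterated. *)
Definition deriv_num (K : numFieldType) m n (N : 'M[{poly K}]_(m, n))
    (D : {poly K}) : 'M[{poly K}]_(m, n) :=
  \matrix_(i, j) ((N i j)^`() * D - N i j * D^`()).

Lemma is_derive_ratmx (K : numFieldType) m n (N : 'M[{poly K}]_(m, n))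
    (D : {poly K}) (x : K) i j : D.[x] != 0 ->
  is_derive x 1 (fun s => ratmx N D s i j : K)
    (ratmx (deriv_num N D) (D ^+ 2) x i j).
Proof.
move=> Dx; rewrite !mxE.
rewrite (_ : (fun s => _) = fun s => (N i j).[s] / D.[s]).
  exact: is_derive_ratio.
by apply/funext => s; rewrite mxE.
Qed.

Lemma derive1_near_ratmx (K : numFieldType) m n (F : K -> 'M[K]_(m, n))
    (N : 'M[{poly K}]_(m, n)) (D : {poly K}) (x : K) :
  D.[x] != 0 -> (\forall s \near x, F s = ratmx N D s) ->
  derive1 F x = ratmx (deriv_num N D) (D ^+ 2) x.
Proof.
move=> Dx FE; rewrite derive1E (near_eq_derive _ FE) -derive1E.
by apply: derive1_mx_entrywise => i j; exact: is_derive_ratmx.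
Qed.

Lemma derive1n_ratmx (K : numFieldType) m n (F : K -> 'M[K]_(m, n))
    (N : 'M[{poly K}]_(m, n)) (D : {poly K}) (x : K) :
  D.[x] != 0 -> (forall s, D.[s] != 0 -> F s = ratmx N D s) ->
  derive1n 1 F x = ratmx (deriv_num N D) (D ^+ 2) x /\
  derive1n 2 F x = ratmx (deriv_num (deriv_num N D) (D ^+ 2)) ((D ^+ 2) ^+ 2) x.
Proof.
move=> Dx FE; have nD := near_horner_neq0 Dx.
(* Differentiating a second time requires the first derivative on a neighbourhood of [x]; the
   formula is proved on the open set where [D] does not vanish. *)
have D1 s : D.[s] != 0 -> derive1 F s = ratmx (deriv_num N D) (D ^+ 2) s.
  move=> Ds; apply: derive1_near_ratmx => //.
  by apply: filterS (near_horner_neq0 Ds) => t; exact: FE.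
split; first by rewrite derive1n1 D1.
rewrite derive1nS derive1n1; apply: derive1_near_ratmx.
  by rewrite horner_exp expf_neq0.
by apply: filterS nD => t; exact: D1.
Qed.

(** Cramer's rule: the inverse of the pencil is its adjugate over its determinant. A general [E1]
    lets the same lemma cover both the full and the reduced function. At a zero of [D], [invmx]
    returns its argument, so the identity is asserted only off these zeros. *)
Lemma resolvent_ratmx (K : numFieldType) n r d (P : 'I_d.+1 -> 'M[K]_n)
    (E0 E1 : 'M[K]_r) (B : 'M[K]_(r, n)) (C : 'M[K]_(n, r)) :
  exists (N : 'M[{poly K}]_n) (D : {poly K}),
    (forall s, D.[s] = \det (s *: E1 - E0)) /\
    (forall s, D.[s] != 0 ->
       \sum_(i < d.+1) s ^+ i *: P i + C *m invmx (s *: E1 - E0) *m B =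
       ratmx N D s).
Proof.
pose X := 'X *: map_mx polyC E1 - map_mx polyC E0.
have XE s : map_mx (horner_eval s) X = s *: E1 - E0.
  by apply/matrixP => i j; rewrite !mxE /horner_eval /= !hornerE.
(* The polynomial part is multiplied by [\det X] to bring it over the common denominator. *)
exists (\det X *: (\sum_(i < d.+1) 'X^i *: map_mx polyC (P i)) +
  map_mx polyC C *m \adj X *m map_mx polyC B), (\det X).
have DE s : (\det X).[s] = \det (s *: E1 - E0).
  by rewrite -XE det_map_mx.
split=> // s Ds.
have cK p q (M : 'M[K]_(p, q)) : map_mx (horner_eval s) (map_mx polyC M) = M.
  by apply/matrixP => i j; rewrite !mxE /horner_eval hornerC.
have <- : (\det X).[s]^-1 *: map_mx (horner_eval s)
   (\det X *: (\sum_(i < d.+1) 'X^i *: map_mx polyC (P i)) +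
    map_mx polyC C *m \adj X *m map_mx polyC B) = ratmx
   (\det X *: (\sum_(i < d.+1) 'X^i *: map_mx polyC (P i)) +
    map_mx polyC C *m \adj X *m map_mx polyC B) (\det X) s.
  by apply/matrixP => i j; rewrite !mxE /horner_eval mulrC.
rewrite map_mxD map_mxZ !map_mxM map_mx_adj !cK XE scalerDr scalerA.
rewrite [X in _ * X](_ : _ = (\det X).[s]) // mulVf // scale1r map_mx_sum.
congr (_ + _).
  apply: eq_bigr => i _; rewrite map_mxZ cK; congr (_ *: _).
  by rewrite /= horner_evalE hornerXn.
rewrite DE in Ds *.
by rewrite /invmx unitmxE unitfE Ds -scalemxAr -scalemxAl.
Qed.

(** * From complex derivatives to partial derivatives *)

Section ComplexPlane.
Variable R : realType.
Local Notation K := (R[i] : numFieldType).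
Implicit Types (z w : R[i]) (p v : R * R).

Definition pt_cplx p : R[i] := Complex p.1 p.2.

Lemma normc_Re_le z : (`|complex.Re z|%:C)%C <= `|z|.
Proof.
by rewrite normc_def lecR -sqrtr_sqr ler_wsqrtr // lerDl sqr_ge0.
Qed.

Lemma normc_Im_le z : (`|complex.Im z|%:C)%C <= `|z|.
Proof.
by rewrite normc_def lecR -sqrtr_sqr ler_wsqrtr // lerDr sqr_ge0.
Qed.

Lemma normc_le_ReIm z : `|z| <= ((`|complex.Re z| + `|complex.Im z|)%:C)%C.
Proof.
rewrite {1}[z]complexE rmorphD (le_trans (ler_normD _ _)) // lerD //.
  by rewrite normc_def lecR /= expr0n addr0 sqrtr_sqr.
have -> : ('i * (complex.Im z)%:C = Complex 0 (complex.Im z))%C by simpc.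
by rewrite normc_def lecR /= expr0n add0r sqrtr_sqr.
Qed.

Lemma complex_gt0P z : 0 < z -> exists2 e : R, 0 < e & z = (e%:C)%C.
Proof.
case: z => a b; rewrite ltcE /= => /andP[/eqP-> a0]; by exists a.
Qed.

Lemma continuous_Re : continuous (@complex.Re R : K -> R).
Proof.
move=> z; apply/(@cvgrPdist_lt _ _ _ _ (nbhs_filter (z : K))) => e e0.
have eC : 0 < (e%:C)%C :> R[i] by rewrite ltcR.
exists (e%:C)%C => // w /= zw; rewrite -ltcR; apply: le_lt_trans zw.
rewrite -raddfB; exact: normc_Re_le.
Qed.

Lemma continuous_Im : continuous (@complex.Im R : K -> R).
Proof.
move=> z; apply/(@cvgrPdist_lt _ _ _ _ (nbhs_filter (z : K))) => e e0.
have eC : 0 < (e%:C)%C :> R[i] by rewrite ltcR.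
exists (e%:C)%C => // w /= zw; rewrite -ltcR; apply: le_lt_trans zw.
rewrite -raddfB; exact: normc_Im_le.
Qed.

Lemma continuous_pt_cplx : continuous (pt_cplx : R * R -> K).
Proof.
move=> p; apply/cvgrPdist_lt => _ /complex_gt0P[e e0 ->].
have e20 : 0 < e / 2 by rewrite divr_gt0.
have c1 : fst @ p --> p.1 by exact: cvg_fst.
have c2 : snd @ p --> p.2 by exact: cvg_snd.
move/cvgrPdist_lt/(_ _ e20) in c1; move/cvgrPdist_lt/(_ _ e20) in c2.
near=> q.
apply: le_lt_trans (normc_le_ReIm _) _.
rewrite ltcR [ltRHS]splitr ltrD //=; by near: q.
Unshelve. all: by end_near. Qed.
Lemma is_derive_cvg (K : numFieldType) (V W : normedModType K) (f : V -> W)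
    (x v : V) (l : W) :
  (fun h : K => h^-1 *: (f (h *: v + x) - f x)) @ 0^' --> l ->
  is_derive x v f l.
Proof.
move=> cf; apply: DeriveDef; first by apply/cvg_ex; exists l.
exact: cvg_lim cf.
Qed.

(** A nonzero [v] keeps [t *: v] off the origin for [t != 0]; hence a punctured complex limit can be
    restricted to a real line. *)
Lemma cvg_pt_cplx_line v : v != 0 ->
  (fun t : R => pt_cplx (t *: v) : K) @ (0^') --> ((0 : K)^').
Proof.
move=> v0 A [e /= e0 eA].
have /(_ 0) c : continuous (fun t : R => pt_cplx (t *: v) : K).
  move=> t.
  apply: (@continuous_comp R (R * R)%type K (fun t : R => t *: v) pt_cplx).
    exact: scalel_continuous.
  exact: continuous_pt_cplx.
have near0 : \forall t \near (0 : R),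
    ball_ Num.norm (0 : K) e (pt_cplx (t *: v) : K).
  apply: (c (ball_ Num.norm (0 : K) e)).
  by rewrite scale0r; exists e.
suff: \forall t \near ((0 : R)^')%classic, A (pt_cplx (t *: v)) by [].
near=> t; apply: eA; first by near: t; apply: cvg_within near0.
have : t != 0 by near: t; exact: nbhs_dnbhs_neq.
apply: contra_neq.
case: (v) v0 => a b v0 [/eqP + /eqP].
rewrite !mulf_eq0; case: eqP => //= _ /eqP a0 /eqP b0.
by move: v0; rewrite a0 b0 eqxx.
Unshelve. all: by end_near. Qed.

(** The complex difference quotient along the increment [t v] tends to [L]. Multiplying by [v] turns
    the factor [1/(t v)] into [1/t], so the real directional derivative is [v L], which encodes the
    Cauchy-Riemann equations. *)
Lemma cvg_cplx_dir (f : K -> K) (p v : R * R) (L : K) : v != 0 ->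
  is_derive (pt_cplx p : K) 1 f L ->
  (fun t : R => (t^-1)%:C%C * (f (pt_cplx (t *: v + p)) - f (pt_cplx p)) : K)
     @ (0^') --> (pt_cplx v * L : K).
Proof.
move=> v0 [df eL].
have c : (fun t : R => (pt_cplx (t *: v))^-1 *
    (f (pt_cplx (t *: v) + pt_cplx p) - f (pt_cplx p)) : K) @ 0^' --> (L : K).
  have dfL : (fun h : K => h^-1 * (f (h + pt_cplx p) - f (pt_cplx p)) : K) @ 0^'
      --> L.
    rewrite -eL /derive.
    rewrite (_ : (fun h => _) = (fun h => h^-1 *:
      ((f \o shift (pt_cplx p)) (h *: 1) - f (pt_cplx p)))) //.
    by apply/funext => h /=; rewrite [h%:A]mulr1.
  exact: (cvg_comp _ _ (cvg_pt_cplx_line v0) dfL).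
have c' := cvgM (@cvg_cst _ (pt_cplx v : K) _ _ _) c.
apply: cvg_trans (c' _ _).
apply: near_eq_cvg; near=> t.
have t0 : t != 0 by near: t; exact: nbhs_dnbhs_neq.
have -> : pt_cplx (t *: v + p) = pt_cplx (t *: v) + pt_cplx p by [].
have tE : pt_cplx (t *: v) = t%:C%C * pt_cplx v.
  by rewrite /pt_cplx /=; simpc.
have zv0 : pt_cplx v != 0.
  by apply: contra_neq v0; case: (v) => a b [-> ->].
rewrite /= mulrA; congr (_ * _).
by rewrite tE invfM mulrCA divff // mulr1 fmorphV.
Unshelve. all: by end_near. Qed.

(** The real part is continuous and linear over [R], so it passes through the limit of the real
    difference quotients. *)
Lemma is_derive_Re_dir (f : K -> K) (p v : R * R) (L : K) : v != 0 ->
  is_derive (pt_cplx p : K) 1 f L ->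
  is_derive p v (fun q => complex.Re (f (pt_cplx q)) : R)
    (complex.Re (pt_cplx v * L)).
Proof.
move=> v0 df; apply: is_derive_cvg.
have c := continuous_cvg _ (@continuous_Re (pt_cplx v * L))
  (cvg_cplx_dir v0 df).
apply: cvg_trans (c _); apply: near_eq_cvg; near=> t.
rewrite /= -raddfB.
by case: (f _ - f _) => a b /=; rewrite mul0r subr0.
Unshelve. all: by end_near.
Qed.

Lemma is_derive_Im_dir (f : K -> K) (p v : R * R) (L : K) : v != 0 ->
  is_derive (pt_cplx p : K) 1 f L ->
  is_derive p v (fun q => complex.Im (f (pt_cplx q)) : R)
    (complex.Im (pt_cplx v * L)).
Proof.
move=> v0 df; apply: is_derive_cvg.
have c := continuous_cvg _ (@continuous_Im (pt_cplx v * L))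
  (cvg_cplx_dir v0 df).
apply: cvg_trans (c _); apply: near_eq_cvg; near=> t.
rewrite /= -raddfB.
by case: (f _ - f _) => a b /=; rewrite mul0r addr0.
Unshelve. all: by end_near.
Qed.
End ComplexPlane.

(** * Functions with the same 2-jet at a point *)

Section Jets.
Variables (R : realType) (V : normedModType R) (I : Type) (e : I -> V).
Implicit Types (g h : V -> R) (p : V).

Definition same_jet1 g h p := g p = h p /\
  forall a, [/\ derivable g p (e a), derivable h p (e a)
    & 'D_(e a) g p = 'D_(e a) h p].

(** Derivability is asked on a neighbourhood so that the sum and product rules hold as identities of
    functions near [p] and can be differentiated again. Continuity is recorded separately because
    directional derivatives do not imply it. *)
Definition loc_smooth g p := \forall x \near p,
  {for x, continuous g} /\ forall a, derivable g x (e a).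

Definition same_jet2 g h p := [/\ loc_smooth g p, loc_smooth h p,
  same_jet1 g h p & forall a, same_jet1 ('D_(e a) g) ('D_(e a) h) p].

Lemma same_jet1_ext (f f' g g' : V -> R) p : f =1 f' -> g =1 g' ->
  same_jet1 f g p -> same_jet1 f' g' p.
Proof. by move=> /funext <- /funext <-. Qed.

Lemma same_jet2_ext (f f' g g' : V -> R) p : f =1 f' -> g =1 g' ->
  same_jet2 f g p -> same_jet2 f' g' p.
Proof. by move=> /funext <- /funext <-. Qed.

(** Jets depend only on germs. This allows a derivative to be replaced by any explicit formula for
    it that is valid near [p]. *)
Lemma same_jet1_near g g' h h' p :
  (\forall x \near p, g x = g' x) -> (\forall x \near p, h x = h' x) ->
  same_jet1 g h p -> same_jet1 g' h' p.
Proof.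
move=> gg hh [E J]; split.
  by rewrite -(nbhs_singleton gg) -(nbhs_singleton hh).
move=> a; have [dg dh Dgh] := J a; split.
- exact: near_eq_derivable gg dg.
- exact: near_eq_derivable hh dh.
- by rewrite -(near_eq_derive _ gg) -(near_eq_derive _ hh).
Qed.

Lemma same_jet1_cst c p : same_jet1 (cst c) (cst c) p.
Proof. by split=> // a; split => //; exact: derivable_cst. Qed.

Lemma same_jet1D g g' h h' p : same_jet1 g h p -> same_jet1 g' h' p ->
  same_jet1 (fun x => g x + g' x) (fun x => h x + h' x) p.
Proof.
move=> [E J] [E' J']; split; first by rewrite E E'.
move=> a; have [dg dh D] := J a; have [dg' dh' D'] := J' a; split.
- exact: (derivableD dg dg').
- exact: (derivableD dh dh').
- by rewrite (deriveD dg dg') (deriveD dh dh') D D'.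
Qed.

Lemma same_jet1M g g' h h' p : same_jet1 g h p -> same_jet1 g' h' p ->
  same_jet1 (fun x => g x * g' x) (fun x => h x * h' x) p.
Proof.
move=> [E J] [E' J']; split; first by rewrite E E'.
move=> a; have [dg dh D] := J a; have [dg' dh' D'] := J' a; split.
- exact: (derivableM dg dg').
- exact: (derivableM dh dh').
- by rewrite (deriveM dg dg') (deriveM dh dh') D D' E E'.
Qed.

Lemma same_jet1V g h p : g p != 0 -> same_jet1 g h p ->
  same_jet1 (fun x => (g x)^-1) (fun x => (h x)^-1) p.
Proof.
move=> g0 [E J]; split; first by rewrite E.
have h0 : h p != 0 by rewrite -E.
move=> a; have [dg dh D] := J a; split.
- exact: (derivableV g0 dg).
- exact: (derivableV h0 dh).
- by rewrite (deriveV g0 dg) (deriveV h0 dh) D E.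
Qed.

Lemma same_jet1X g h p n : same_jet1 g h p ->
  same_jet1 (fun x => g x ^+ n) (fun x => h x ^+ n) p.
Proof.
move=> J; elim: n => [|n IHn]; first exact: (same_jet1_cst 1).
by apply: same_jet1_ext (same_jet1M J IHn) => x; rewrite exprS.
Qed.

Lemma same_jet1_sum (J : Type) (s : seq J) (G H : J -> V -> R) p :
  (forall j, same_jet1 (G j) (H j) p) ->
  same_jet1 (fun x => \sum_(j <- s) G j x) (fun x => \sum_(j <- s) H j x) p.
Proof.
move=> GH; elim: s => [|j s IHs].
  by apply: same_jet1_ext (same_jet1_cst 0 p) => x; rewrite big_nil.
by apply: same_jet1_ext (same_jet1D (GH j) IHs) => x; rewrite big_cons.
Qed.

Lemma same_jet2_cst c p : same_jet2 (cst c) (cst c) p.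
Proof.
have lc : loc_smooth (cst c) p.
  by apply: nearW => x; split=> [|a];
    [exact: cst_continuous|exact: derivable_cst].
split; [exact: lc|exact: lc|exact: same_jet1_cst|move=> a].
apply: (@same_jet1_near (cst 0) _ (cst 0)); last exact: same_jet1_cst;
  by apply: nearW => x; rewrite derive_cst.
Qed.

Lemma loc_smoothD g g' p : loc_smooth g p -> loc_smooth g' p ->
  loc_smooth (fun x => g x + g' x) p.
Proof.
apply: filterS2 => x [cg dg] [cg' dg']; split; first exact: cvgD.
by move=> a; exact: (derivableD (dg a) (dg' a)).
Qed.

Lemma loc_smoothM g g' p : loc_smooth g p -> loc_smooth g' p ->
  loc_smooth (fun x => g x * g' x) p.
Proof.
apply: filterS2 => x [cg dg] [cg' dg']; split; first exact: cvgM.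
by move=> a; exact: (derivableM (dg a) (dg' a)).
Qed.

Lemma near_deriveD g g' p : loc_smooth g p -> loc_smooth g' p -> forall a,
  \forall x \near p, 'D_(e a) g x + 'D_(e a) g' x =
    'D_(e a) (fun x => g x + g' x) x.
Proof.
move=> lg lg' a; apply: filterS2 lg lg' => x [_ dg] [_ dg'].
by rewrite (deriveD (dg a) (dg' a)).
Qed.

Lemma near_deriveM g g' p : loc_smooth g p -> loc_smooth g' p -> forall a,
  \forall x \near p, g x * 'D_(e a) g' x + g' x * 'D_(e a) g x =
    'D_(e a) (fun x => g x * g' x) x.
Proof.
move=> lg lg' a; apply: filterS2 lg lg' => x [_ dg] [_ dg'].
by rewrite (deriveM (dg a) (dg' a)).
Qed.

Lemma same_jet2D g g' h h' p : same_jet2 g h p -> same_jet2 g' h' p ->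
  same_jet2 (fun x => g x + g' x) (fun x => h x + h' x) p.
Proof.
move=> [lg lh J D] [lg' lh' J' D']; split.
- exact: loc_smoothD.
- exact: loc_smoothD.
- exact: same_jet1D.
- move=> a; apply: (same_jet1_near (near_deriveD lg lg' a)
    (near_deriveD lh lh' a)).
  exact: same_jet1D.
Qed.

(** Near [p] each derivative of the product is its Leibniz expression, whose ingredients all have
    matching 1-jets. *)
Lemma same_jet2M g g' h h' p : same_jet2 g h p -> same_jet2 g' h' p ->
  same_jet2 (fun x => g x * g' x) (fun x => h x * h' x) p.
Proof.
move=> [lg lh J D] [lg' lh' J' D']; split.
- exact: loc_smoothM.
- exact: loc_smoothM.
- exact: same_jet1M.
- move=> a; apply: (same_jet1_near (near_deriveM lg lg' a)
    (near_deriveM lh lh' a)).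
  by apply: same_jet1D; exact: same_jet1M.
Qed.

Lemma same_jet2N g h p : same_jet2 g h p ->
  same_jet2 (fun x => - g x) (fun x => - h x) p.
Proof.
move=> J; apply: same_jet2_ext (same_jet2M (same_jet2_cst (-1) p) J) => x /=;
  by rewrite mulN1r.
Qed.

(** Real and imaginary parts are tracked apart because conjugation, which enters through [ctmx], is
    smooth over [R] but not holomorphic. *)
Definition csame_jet2 (f g : V -> R[i]) p :=
  same_jet2 (fun x => complex.Re (f x)) (fun x => complex.Re (g x)) p /\
  same_jet2 (fun x => complex.Im (f x)) (fun x => complex.Im (g x)) p.

Lemma csame_jet2_ext (f f' g g' : V -> R[i]) p : f =1 f' -> g =1 g' ->
  csame_jet2 f g p -> csame_jet2 f' g' p.
Proof. by move=> /funext <- /funext <-. Qed.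

Lemma csame_jet2_cst c p : csame_jet2 (fun=> c) (fun=> c) p.
Proof. by split; exact: same_jet2_cst. Qed.

Lemma csame_jet2D (f f' g g' : V -> R[i]) p :
  csame_jet2 f g p -> csame_jet2 f' g' p ->
  csame_jet2 (fun x => f x + f' x) (fun x => g x + g' x) p.
Proof.
move=> [J1 J2] [J1' J2']; split.
- by apply: same_jet2_ext (same_jet2D J1 J1') => x; rewrite raddfD.
- by apply: same_jet2_ext (same_jet2D J2 J2') => x; rewrite raddfD.
Qed.

Lemma csame_jet2M (f f' g g' : V -> R[i]) p :
  csame_jet2 f g p -> csame_jet2 f' g' p ->
  csame_jet2 (fun x => f x * f' x) (fun x => g x * g' x) p.
Proof.
move=> [J1 J2] [J1' J2']; split.
- apply: same_jet2_ext (same_jet2D (same_jet2M J1 J1')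
    (same_jet2N (same_jet2M J2 J2'))) => x.
  + by case: (f x) (f' x) => a b [].
  + by case: (g x) (g' x) => a b [].
- apply: same_jet2_ext (same_jet2D (same_jet2M J1 J2')
    (same_jet2M J2 J1')) => x.
  + by case: (f x) (f' x) => a b [c d].
  + by case: (g x) (g' x) => a b [c d].
Qed.

Lemma csame_jet2_conj (f g : V -> R[i]) p : csame_jet2 f g p ->
  csame_jet2 (fun x => (f x)^*) (fun x => (g x)^*) p.
Proof.
move=> [J1 J2]; split.
- by apply: same_jet2_ext J1 => x; [case: (f x)|case: (g x)].
- by apply: same_jet2_ext (same_jet2N J2) => x; [case: (f x)|case: (g x)].
Qed.

Lemma csame_jet2_sum (J : Type) (s : seq J) (F G : J -> V -> R[i]) p :
  (forall j, csame_jet2 (F j) (G j) p) ->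
  csame_jet2 (fun x => \sum_(j <- s) F j x) (fun x => \sum_(j <- s) G j x) p.
Proof.
move=> FG; elim: s => [|j s IHs].
  by apply: csame_jet2_ext (csame_jet2_cst 0 p) => x; rewrite big_nil.
by apply: csame_jet2_ext (csame_jet2D (FG j) IHs) => x; rewrite big_cons.
Qed.

(** * Coefficientwise jets of polynomials, up to the characteristic polynomial *)

Definition psame_jet2 (f g : V -> {poly R[i]}) p :=
  forall i, csame_jet2 (fun x => (f x)`_i) (fun x => (g x)`_i) p.

Lemma psame_jet2_ext (f f' g g' : V -> {poly R[i]}) p : f =1 f' -> g =1 g' ->
  psame_jet2 f g p -> psame_jet2 f' g' p.
Proof. by move=> /funext <- /funext <-. Qed.

Lemma psame_jet2_cst c p : psame_jet2 (fun=> c) (fun=> c) p.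
Proof. by move=> i; exact: csame_jet2_cst. Qed.

Lemma psame_jet2D (f f' g g' : V -> {poly R[i]}) p :
  psame_jet2 f g p -> psame_jet2 f' g' p ->
  psame_jet2 (fun x => f x + f' x) (fun x => g x + g' x) p.
Proof.
by move=> J J' i; apply: csame_jet2_ext (csame_jet2D (J i) (J' i)) => x;
  rewrite coefD.
Qed.

Lemma psame_jet2M (f f' g g' : V -> {poly R[i]}) p :
  psame_jet2 f g p -> psame_jet2 f' g' p ->
  psame_jet2 (fun x => f x * f' x) (fun x => g x * g' x) p.
Proof.
move=> J J' i.
by apply: csame_jet2_ext (csame_jet2_sum (index_enum 'I_i.+1)
  (fun j : 'I_i.+1 => csame_jet2M (J j) (J' (i - j)%N))) => x; rewrite coefM.
Qed.

Lemma psame_jet2_sum (J : Type) (s : seq J) (F G : J -> V -> {poly R[i]}) p :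
  (forall j, psame_jet2 (F j) (G j) p) ->
  psame_jet2 (fun x => \sum_(j <- s) F j x) (fun x => \sum_(j <- s) G j x) p.
Proof.
by move=> FG i; apply: csame_jet2_ext (csame_jet2_sum s (FG^~ i)) => x;
  rewrite coef_sum.
Qed.

Lemma psame_jet2_prod (J : Type) (s : seq J) (F G : J -> V -> {poly R[i]}) p :
  (forall j, psame_jet2 (F j) (G j) p) ->
  psame_jet2 (fun x => \prod_(j <- s) F j x) (fun x => \prod_(j <- s) G j x) p.
Proof.
move=> FG; elim: s => [|j s IHs].
  by apply: psame_jet2_ext (psame_jet2_cst 1 p) => x; rewrite big_nil.
by apply: psame_jet2_ext (psame_jet2M (FG j) IHs) => x; rewrite big_cons.
Qed.

Lemma psame_jet2C (f g : V -> R[i]) p : csame_jet2 f g p ->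
  psame_jet2 (fun x => (f x)%:P) (fun x => (g x)%:P) p.
Proof.
move=> J [|i].
  by apply: csame_jet2_ext J => x; rewrite coefC.
by apply: csame_jet2_ext (csame_jet2_cst 0 p) => x; rewrite coefC.
Qed.

(** By the Leibniz expansion of the determinant, the coefficients are polynomials in the entries;
    closure under sums and products then suffices. *)
Lemma psame_jet2_char_poly n (F G : V -> 'M[R[i]]_n) p :
  (forall i j, csame_jet2 (fun x => F x i j) (fun x => G x i j) p) ->
  psame_jet2 (fun x => char_poly (F x)) (fun x => char_poly (G x)) p.
Proof.
move=> J.
(* The sign of the entry is written as a factor [(-1)%:P], so that only sums, products and constants
   occur. *)
have E (H : V -> 'M[R[i]]_n) : (fun x => char_poly (H x)) = fun x =>
  \sum_(s : 'S_n) ((-1) ^+ s * \prod_(i < n)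
     ('X *+ (i == s i) + (-1)%:P * (H x i (s i))%:P)).
  apply/funext => x; apply: eq_bigr => s _; congr (_ * _).
  by apply: eq_bigr => i _; rewrite !mxE polyCN mulN1r.
rewrite !E; apply: psame_jet2_sum => s.
apply: psame_jet2M; first exact: psame_jet2_cst.
apply: psame_jet2_prod => i; apply: psame_jet2D; first exact: psame_jet2_cst.
apply: psame_jet2M; first exact: psame_jet2_cst.
exact: psame_jet2C.
Qed.

Lemma csame_jet2_Mof n (F G : V -> 'M[R[i]]_n) p :
  (forall i j, csame_jet2 (fun x => F x i j) (fun x => G x i j) p) ->
  forall i j, csame_jet2 (fun x => (ctmx (F x) *m F x) i j)
                         (fun x => (ctmx (G x) *m G x) i j) p.
Proof.
move=> J i j.
by apply: csame_jet2_ext (csame_jet2_sum (index_enum 'I_n)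
  (fun k => csame_jet2M (csame_jet2_conj (J k i)) (J k j))) => x; rewrite mxE;
  apply: eq_bigr => k _; rewrite !mxE.
Qed.

End Jets.

(** * From equal complex derivatives up to order two to equal real 2-jets *)

Section Holomorphic.
Variable R : realType.
Local Notation K := (R[i] : numFieldType).
Local Notation same_jet1 := (@same_jet1 R (R * R)%type 'I_2 (@dir R)).
Local Notation same_jet2 := (@same_jet2 R (R * R)%type 'I_2 (@dir R)).
Local Notation csame_jet2 := (@csame_jet2 R (R * R)%type 'I_2 (@dir R)).

Lemma dir_neq0 a : dir R a != 0.
Proof.
by rewrite /dir; case: ifP => _; apply/eqP => -[] /eqP; rewrite ?oner_eq0.
Qed.

Lemma near_pt_cplx (p : R * R) (P : set K) :
  (\forall s \near (pt_cplx p : K), P s) -> \forall q \near p, P (pt_cplx q).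
Proof. exact: continuous_pt_cplx. Qed.

Lemma same_jet1_Re (f g : K -> K) (L : K) (p : R * R) :
  is_derive (pt_cplx p : K) 1 f L -> is_derive (pt_cplx p : K) 1 g L ->
  f (pt_cplx p) = g (pt_cplx p) ->
  same_jet1 (fun q => complex.Re (f (pt_cplx q)))
            (fun q => complex.Re (g (pt_cplx q))) p.
Proof.
move=> df dg E; split=> [|a]; first by rewrite E.
have [d1 e1] := is_derive_Re_dir (dir_neq0 a) df.
have [d2 e2] := is_derive_Re_dir (dir_neq0 a) dg.
by split=> //; rewrite e1 e2.
Qed.

Lemma same_jet1_Im (f g : K -> K) (L : K) (p : R * R) :
  is_derive (pt_cplx p : K) 1 f L -> is_derive (pt_cplx p : K) 1 g L ->
  f (pt_cplx p) = g (pt_cplx p) ->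
  same_jet1 (fun q => complex.Im (f (pt_cplx q)))
            (fun q => complex.Im (g (pt_cplx q))) p.
Proof.
move=> df dg E; split=> [|a]; first by rewrite E.
have [d1 e1] := is_derive_Im_dir (dir_neq0 a) df.
have [d2 e2] := is_derive_Im_dir (dir_neq0 a) dg.
by split=> //; rewrite e1 e2.
Qed.

Lemma loc_smooth_Re (f f1 : K -> K) (p : R * R) :
  (\forall s \near (pt_cplx p : K), is_derive (s : K) 1 f (f1 s)) ->
  loc_smooth (@dir R) (fun q => complex.Re (f (pt_cplx q))) p.
Proof.
move=> /near_pt_cplx; apply: filterS => q df; split=> [|a].
  apply: (@continuous_comp _ _ R (fun q => f (pt_cplx q)) (@complex.Re R));
    last exact: continuous_Re.
  apply: (@continuous_comp _ K K (@pt_cplx R) f);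
    first exact: continuous_pt_cplx.
  by apply: derivable1_continuous; have [] := df.
by have [] := is_derive_Re_dir (dir_neq0 a) df.
Qed.

Lemma loc_smooth_Im (f f1 : K -> K) (p : R * R) :
  (\forall s \near (pt_cplx p : K), is_derive (s : K) 1 f (f1 s)) ->
  loc_smooth (@dir R) (fun q => complex.Im (f (pt_cplx q))) p.
Proof.
move=> /near_pt_cplx; apply: filterS => q df; split=> [|a].
  apply: (@continuous_comp _ _ R (fun q => f (pt_cplx q)) (@complex.Im R));
    last exact: continuous_Im.
  apply: (@continuous_comp _ K K (@pt_cplx R) f);
    first exact: continuous_pt_cplx.
  by apply: derivable1_continuous; have [] := df.
by have [] := is_derive_Im_dir (dir_neq0 a) df.
Qed.

(** Near [p] the derivative of [Re f] along [v] is [Re (v f1)], again the real part of a function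
    with a complex derivative. The first-order statement is therefore applied twice, to [f] and then
    to [v f1]; imaginary parts are handled alike. *)
Lemma csame_jet2_holomorphic (f g f1 g1 : K -> K) (L : K) (p : R * R) :
  (\forall s \near (pt_cplx p : K), is_derive (s : K) 1 f (f1 s)) ->
  (\forall s \near (pt_cplx p : K), is_derive (s : K) 1 g (g1 s)) ->
  is_derive (pt_cplx p : K) 1 f1 L -> is_derive (pt_cplx p : K) 1 g1 L ->
  f (pt_cplx p) = g (pt_cplx p) -> f1 (pt_cplx p) = g1 (pt_cplx p) ->
  csame_jet2 (fun q => f (pt_cplx q)) (fun q => g (pt_cplx q)) p.
Proof.
move=> nf ng df1 dg1 E E1.
have df := nbhs_singleton nf; have dg := nbhs_singleton ng.
(* Now [f] and [g] have literally the same derivative value at the point, as the first-order lemmas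
   demand. *)
rewrite E1 in df.
have dZ (h : K -> K) (c : K) : is_derive (pt_cplx p : K) 1 h L ->
    is_derive (pt_cplx p : K) 1 (fun s => c * h s) (c * L).
  exact: is_deriveZ.
have DRe (h h1 : K -> K) a :
    (\forall s \near (pt_cplx p : K), is_derive (s : K) 1 h (h1 s)) ->
    \forall q \near p, complex.Re (pt_cplx (dir R a) * h1 (pt_cplx q)) =
      'D_(dir R a) (fun q => complex.Re (h (pt_cplx q))) q.
  move=> /near_pt_cplx; apply: filterS => q dh.
  by have [_ ->] := is_derive_Re_dir (dir_neq0 a) dh.
have DIm (h h1 : K -> K) a :
    (\forall s \near (pt_cplx p : K), is_derive (s : K) 1 h (h1 s)) ->
    \forall q \near p, complex.Im (pt_cplx (dir R a) * h1 (pt_cplx q)) =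
      'D_(dir R a) (fun q => complex.Im (h (pt_cplx q))) q.
  move=> /near_pt_cplx; apply: filterS => q dh.
  by have [_ ->] := is_derive_Im_dir (dir_neq0 a) dh.
split; split.
- exact: loc_smooth_Re nf.
- exact: loc_smooth_Re ng.
- exact: same_jet1_Re df dg E.
- move=> a; apply: (same_jet1_near (DRe _ _ a nf) (DRe _ _ a ng)).
  by apply: (same_jet1_Re (dZ _ _ df1) (dZ _ _ dg1)); rewrite E1.
- exact: loc_smooth_Im nf.
- exact: loc_smooth_Im ng.
- exact: same_jet1_Im df dg E.
- move=> a; apply: (same_jet1_near (DIm _ _ a nf) (DIm _ _ a ng)).
  by apply: (same_jet1_Im (dZ _ _ df1) (dZ _ _ dg1)); rewrite E1.
Qed.

Lemma csame_jet2_ratmx n (F G : K -> 'M[K]_n) (N N' : 'M[{poly K}]_n)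
    (D D' : {poly K}) (p : R * R) :
  let s := pt_cplx p : K in
  D.[s] != 0 -> D'.[s] != 0 ->
  (forall s, D.[s] != 0 -> F s = ratmx N D s) ->
  (forall s, D'.[s] != 0 -> G s = ratmx N' D' s) ->
  F s = G s -> derive1n 1 F s = derive1n 1 G s ->
  derive1n 2 F s = derive1n 2 G s ->
  forall i j, csame_jet2 (fun q => F (pt_cplx q) i j)
                         (fun q => G (pt_cplx q) i j) p.
Proof.
move=> s Ds Ds' FE GE E0 E1 E2 i j.
have [F1 F2] := derive1n_ratmx Ds FE.
have [G1 G2] := derive1n_ratmx Ds' GE.
have near_der (H : K -> 'M[K]_n) M Q (t : K) : Q.[t] != 0 ->
    (forall s, Q.[s] != 0 -> H s = ratmx M Q s) ->
    is_derive t 1 (fun s => H s i j : K) (ratmx (deriv_num M Q) (Q ^+ 2) t i j).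
  move=> Qt HE; apply: near_eq_is_derive (is_derive_ratmx M i j Qt).
  by apply: filterS (near_horner_neq0 Qt) => y Qy; rewrite HE.
apply: (@csame_jet2_holomorphic (fun t => F t i j) (fun t => G t i j)
  (fun t => ratmx (deriv_num N D) (D ^+ 2) t i j)
  (fun t => ratmx (deriv_num N' D') (D' ^+ 2) t i j) (derive1n 2 F s i j)).
- by apply: filterS (near_horner_neq0 Ds) => t Dt; exact: near_der.
- by apply: filterS (near_horner_neq0 Ds') => t Dt; exact: near_der.
- by rewrite F2; apply: is_derive_ratmx; rewrite horner_exp expf_neq0.
- by rewrite E2 G2; apply: is_derive_ratmx; rewrite horner_exp expf_neq0.
- by rewrite [LHS](congr1 (fun M : 'M[K]_n => M i j) E0).
- by rewrite -F1 -G1 E1.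
Qed.
End Holomorphic.

(** * Eigenvalues of Hermitian matrices and their continuity *)

Section HermitianEigenvalues.
Variable R : realType.
Local Notation C := (R[i]).

Lemma ctmxK m n (A : 'M[C]_(m, n)) : ctmx (ctmx A) = A.
Proof. by apply/matrixP => i j; rewrite !mxE conjCK. Qed.

Lemma ctmxM m n p (A : 'M[C]_(m, n)) (B : 'M[C]_(n, p)) :
  ctmx (A *m B) = ctmx B *m ctmx A.
Proof. by rewrite /ctmx map_mxM trmx_mul. Qed.

Lemma ctmx_Mof n (F : C -> 'M[C]_n) s : ctmx (Mof F s) = Mof F s.
Proof. by rewrite /Mof ctmxM ctmxK. Qed.

Lemma hermitian_diagonalization n (M : 'M[C]_n) : ctmx M = M ->
  exists (U : 'M[C]_n) (d : 'I_n -> R),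
    [/\ ctmx U *m U = 1%:M, U *m ctmx U = 1%:M
      & M = ctmx U *m diag_mx (\row_i (d i)%:C%C) *m U].
Proof.
move=> Mh.
have hM : M \is hermitianmx _ false Num.conj.
  by apply/is_hermitianmxP; rewrite expr0 scale1r -map_trmx -[LHS]Mh.
have dr := hermitian_spectral_diag_real hM.
have /orthomx_spectralP ME := hermitian_normalmx hM.
have Uu := spectral_unitarymx M.
have UcE : ctmx (spectralmx M) = invmx (spectralmx M).
  by rewrite invmx_unitary // /ctmx map_trmx.
exists (spectralmx M), (fun i => complex.Re (spectral_diag M 0 i)).
rewrite UcE; split.
- exact: mulVmx (spectral_unit M).
- exact: mulmxV (spectral_unit M).
rewrite [LHS]ME; congr (_ *m diag_mx _ *m _).
(* The spectral diagonal of a Hermitian matrix is real, so taking real parts loses nothing. *)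
apply/rowP => i; rewrite mxE RRe_real //.
by move/mxOverP: dr; exact.
Qed.

Lemma char_poly_unitary_conj n (U : 'M[C]_n) (d : 'I_n -> R) :
  ctmx U *m U = 1%:M ->
  char_poly (ctmx U *m diag_mx (\row_i (d i)%:C%C) *m U) =
  \prod_(x <- [seq d i | i <- enum 'I_n]) ('X - (x%:C)%C%:P).
Proof.
move=> UU; set D := diag_mx _.
have -> : char_poly (ctmx U *m D *m U) = char_poly D.
  rewrite /char_poly.
  (* Similarity is applied to the polynomial matrix [X - D]: scalar matrices commute with [U], and
     the determinants of [ctmx U] and [U] cancel. *)
  have <- : map_mx polyC (ctmx U) *m char_poly_mx D *m map_mx polyC U =
      char_poly_mx (ctmx U *m D *m U).
    rewrite /char_poly_mx mulmxBr mulmxBl !map_mxM; congr (_ - _).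
    by rewrite scalar_mxC -mulmxA -map_mxM UU map_mx1 mulmx1.
  rewrite !det_mulmx mulrAC -det_mulmx -map_mxM UU map_mx1 det1.
  by rewrite mul1r.
rewrite char_poly_trig ?diag_mx_is_trig // big_map big_enum /=.
by apply: eq_bigr => i _; rewrite !mxE eqxx.
Qed.

(** [xget] falls back on a list of zeros unless some list meets the specification; the sorted
    diagonal given by the spectral theorem is such a list. *)
Lemma eigs_descP n (M : 'M[C]_n) : ctmx M = M ->
  sorted (fun x y : R => y <= x) (eigs_desc M) /\
  char_poly M = \prod_(x <- eigs_desc M) ('X - (x%:C)%C%:P).
Proof.
move=> /hermitian_diagonalization[U [d [UU _ ME]]].
rewrite /eigs_desc; apply: (@xgetPex _ _ (fun s : seq R =>
  sorted (fun x y : R => y <= x) s /\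
  char_poly M = \prod_(x <- s) ('X - (x%:C)%C%:P))).
exists (sort (fun x y : R => y <= x) [seq d i | i <- enum 'I_n]).
split; first by apply: sort_sorted => x y; exact: le_total.
rewrite ME char_poly_unitary_conj //; apply: perm_big.
by rewrite perm_sym perm_sort.
Qed.

Lemma size_eigs_desc n (M : 'M[C]_n) : ctmx M = M -> size (eigs_desc M) = n.
Proof.
move=> /eigs_descP[_ /(congr1 (fun p : {poly C} => size p))].
by rewrite size_char_poly size_prod_XsubC => -[].
Qed.

(** A product of monic linear factors determines its roots up to order; the comparison takes place
    over the complex numbers and descends by injectivity of the embedding. *)
Lemma perm_eigs_desc n (M U : 'M[C]_n) (d : 'I_n -> R) : ctmx M = M ->
  ctmx U *m U = 1%:M -> M = ctmx U *m diag_mx (\row_i (d i)%:C%C) *m U ->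
  perm_eq (eigs_desc M) [seq d i | i <- enum 'I_n].
Proof.
move=> Mh UU ME; have [_] := eigs_descP Mh.
rewrite {1}ME char_poly_unitary_conj // => E.
have inj : injective (real_complex R) by exact: complexI.
apply: (perm_map_inj inj); apply: prod_XsubC_eq.
by move: E; rewrite !big_map => ->.
Qed.
End HermitianEigenvalues.

(** * Weyl's inequality in terms of eigenvalue counts *)

Section Weyl.
Variable R : realType.
Local Notation C := (R[i]).

Definition qform n (M : 'M[C]_n) (x : 'rV[C]_n) : C := (x *m M *m ctmx x) 0 0.

Lemma qform_diag n (U : 'M[C]_n) (d : 'I_n -> R) (x : 'rV[C]_n) :
  qform (ctmx U *m diag_mx (\row_i (d i)%:C%C) *m U) x =
  \sum_i (d i)%:C%C * `|(x *m ctmx U) 0 i| ^+ 2.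
Proof.
rewrite /qform.
have -> : x *m (ctmx U *m diag_mx (\row_i (d i)%:C%C) *m U) *m ctmx x =
    (x *m ctmx U) *m diag_mx (\row_i (d i)%:C%C) *m ctmx (x *m ctmx U).
  by rewrite ctmxM ctmxK !mulmxA.
rewrite mxE; apply: eq_bigr => i _.
by rewrite mul_mx_diag !mxE normCK mulrAC mulrC mulrA.
Qed.

Lemma qform1_unitary n (U : 'M[C]_n) (x : 'rV[C]_n) : ctmx U *m U = 1%:M ->
  qform 1%:M x = \sum_i `|(x *m ctmx U) 0 i| ^+ 2.
Proof.
move=> UU; have -> : (1%:M : 'M[C]_n) =
    ctmx U *m diag_mx (\row_i (1 : R)%:C%C) *m U.
  rewrite (_ : diag_mx _ = 1%:M) ?mulmx1 ?UU //.
  by rewrite -diag_const_mx; congr diag_mx; apply/rowP => i; rewrite !mxE.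
by rewrite qform_diag; apply: eq_bigr => i _; rewrite mul1r.
Qed.

Lemma qform1_gt0 n (x : 'rV[C]_n) : x != 0 -> 0 < qform 1%:M x.
Proof.
move=> x0; rewrite /qform mulmx1 mxE.
have E i : x 0 i * ctmx x i 0 = `|x 0 i| ^+ 2 by rewrite !mxE normCK.
rewrite (eq_bigr _ (fun i _ => E i)) lt_neqAle sumr_ge0 ?andbT; last first.
  by move=> i _; rewrite exprn_ge0.
rewrite eq_sym psumr_neq0 => [|i _]; last by rewrite exprn_ge0.
have /rV0Pn[i xi] := x0; apply/hasP; exists i; first by rewrite mem_index_enum.
by rewrite /= exprn_gt0 // normr_gt0.
Qed.

(* Span of the eigenvectors of M above c and span of those of M' below c'
   meet nontrivially as soon as the count drops. *)
Lemma eig_count_mono n (M M' : 'M[C]_n) (b c c' : R) :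
  ctmx M = M -> ctmx M' = M' -> c' < c - b ->
  (forall x : 'rV[C]_n, qform M x <= qform M' x + b%:C%C * qform 1%:M x) ->
  (count (fun y : R => c <= y)%R (eigs_desc M) <=
   count (fun y : R => c' <= y)%R (eigs_desc M'))%N.
Proof.
move=> Mh Mh' cc' MM'.
have [U [d [UU UU' ME]]] := hermitian_diagonalization Mh.
have [U' [d' [VV VV' ME']]] := hermitian_diagonalization Mh'.
rewrite (seq.permP (perm_eigs_desc Mh UU ME)).
rewrite (seq.permP (perm_eigs_desc Mh' VV ME')).
rewrite (count_map d) (count_map d').
pose A := [pred i | c <= d i]; pose B := [pred i | c' <= d' i].
have cE (P : pred 'I_n) : count P (enum 'I_n) = #|P|.
  by rewrite cardE enumT /enum_mem size_filter.
rewrite !cE; change (#|A| <= #|B|)%N.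
rewrite leqNgt; apply/negP => BA.
(* The rows of [U] and [U'] are eigenvectors; [PA] and [PB] keep those with eigenvalue at least [c]
   for [M] and at least [c'] for [M']. *)
pose PA := rowsub (enum_val : 'I_#|A| -> 'I_n) U.
pose PB := rowsub (enum_val : 'I_#|B| -> 'I_n) U'.
(* With more rows than columns, [PA *m ctmx PB] has a nonzero left kernel vector [z]; then [z *m PA]
   lies in the span of [PA] and is orthogonal to all rows of [PB]. *)
have /rowV0Pn[z /sub_kermxP zG z0] : kermx (PA *m ctmx PB) != 0.
  by rewrite kermx_eq0 /row_free neq_ltn (leq_ltn_trans (rank_leq_col _) BA).
pose x := z *m PA.
have PAA : PA *m ctmx PA = 1%:M.
  apply/matrixP => i j; have /matrixP/(_ (enum_val i) (enum_val j)) := UU'.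
  rewrite !mxE (inj_eq enum_val_inj) => <-.
  by apply: eq_bigr => k _; rewrite !mxE.
have x0 : x != 0.
  apply: contra_neq z0 => x0.
  by rewrite -[z]mulmx1 -PAA mulmxA -/x x0 mul0mx.
have yA i : ~~ A i -> (x *m ctmx U) 0 i = 0.
  move=> Ai; rewrite -mulmxA mxE big1 // => a _.
  have /matrixP/(_ (enum_val a) i) := UU'; rewrite !mxE => E.
  rewrite [X in _ * X](_ : _ = 0) ?mulr0 //.
  transitivity ((enum_val a == i)%:R : C).
    by rewrite -E; apply: eq_bigr => k _; rewrite !mxE.
  by case: eqP => // ai; move: Ai (enum_valP a); rewrite -ai => /negP.
have yB i : B i -> (x *m ctmx U') 0 i = 0.
  move=> Bi; have /rowP/(_ (enum_rank_in Bi i)) := zG; rewrite mulmxA.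
  rewrite !mxE => E; rewrite -[RHS]E; apply: eq_bigr => k _.
  by rewrite !mxE enum_rankK_in.
have X0 := qform1_gt0 x0.
have l1 : c%:C%C * qform 1%:M x <= qform M x.
  rewrite ME qform_diag (qform1_unitary _ UU) mulr_sumr ler_sum // => i _.
  have [Ai|/yA ->] := boolP (A i); last by rewrite normr0 expr0n !mulr0.
  by rewrite ler_wpM2r ?exprn_ge0 // lecR.
have l2 : qform M' x <= c'%:C%C * qform 1%:M x.
  rewrite ME' qform_diag (qform1_unitary _ VV) mulr_sumr ler_sum // => i _.
  have [/yB ->|Bi] := boolP (B i); first by rewrite normr0 expr0n !mulr0.
  by rewrite ler_wpM2r ?exprn_ge0 // lecR ltW // ltNge.
(* Cancelling the positive number [qform 1%:M x] would give [c <= c' + b], against the assumed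
   gap. *)
have : c%:C%C * qform 1%:M x <= (c' + b)%:C%C * qform 1%:M x.
  by rewrite (le_trans l1) // (le_trans (MM' x)) // rmorphD mulrDl lerD2r.
by rewrite ler_pM2r // lecR leNgt -ltrBrDr cc'.
Qed.

End Weyl.

(** * Continuity of the sorted eigenvalues *)

Section EigenvalueContinuity.
Variable R : realType.
Local Notation C := (R[i]).

(** A crude bound on the operator norm, real-valued and visibly continuous in the real and imaginary
    parts of the entries. *)
Definition entry_norm n (M : 'M[C]_n) : R :=
  \sum_i \sum_j (`|complex.Re (M i j)| + `|complex.Im (M i j)|).

Lemma qform_le_entry_norm n (D : 'M[C]_n) (x : 'rV[C]_n) : ctmx D = D ->
  qform D x <= (entry_norm D)%:C%C * qform 1%:M x.
Proof.
move=> Dh.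
(* The order on complex numbers compares only numbers with equal imaginary part, so realness must
   precede the bound by the modulus. *)
have Dreal : qform D x \is Num.real.
  have q_herm : ctmx (x *m D *m ctmx x) = x *m D *m ctmx x.
    by rewrite !ctmxM ctmxK Dh mulmxA.
  by apply/CrealP; rewrite /qform -[in RHS]q_herm [RHS]mxE [RHS]mxE.
apply: le_trans (real_ler_norm Dreal) _.
have E : qform 1%:M x = \sum_k `|x 0 k| ^+ 2.
  rewrite /qform mulmx1 mxE; apply: eq_bigr => k _.
  by rewrite !mxE normCK.
have le_sum i : `|x 0 i| ^+ 2 <= qform 1%:M x.
  by rewrite E (bigD1 i) //= lerDl sumr_ge0.
have le_prod i j : `|x 0 i| * `|x 0 j| <= qform 1%:M x.
  (* Arithmetic-geometric mean: twice the product is at most the sum of the squares, each of which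
     is at most [qform 1%:M x]. *)
  have : 0 <= (`|x 0 i| - `|x 0 j|) ^+ 2.
    by apply: real_exprn_even_ge0 => //; apply: realB; exact: normr_real.
  rewrite sqrrB addrAC subr_ge0 => h.
  rewrite -(@ler_pMn2r _ 2) // (le_trans h) // mulr2n.
  by rewrite lerD.
have -> : qform D x = \sum_j \sum_i x 0 i * D i j * (x 0 j)^*.
  rewrite /qform mxE; apply: eq_bigr => j _.
  by rewrite !mxE mulr_suml.
have -> : entry_norm D =
    \sum_j \sum_i (`|complex.Re (D i j)| + `|complex.Im (D i j)|).
  by rewrite /entry_norm exchange_big.
rewrite rmorph_sum mulr_suml (le_trans (ler_norm_sum _ _ _)) //.
rewrite ler_sum // => j _.
rewrite rmorph_sum mulr_suml (le_trans (ler_norm_sum _ _ _)) //.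
rewrite ler_sum // => i _.
rewrite !normrM norm_conjC mulrAC mulrC ler_pM ?mulr_ge0 //.
exact: normc_le_ReIm.
Qed.

(** In a decreasing list the entries at least [c] form a prefix; position [j], counted from 0,
    belongs to it exactly when its length exceeds [j]. *)
Lemma sorted_nth_ge (s : seq R) (c : R) j :
  sorted (fun x y : R => y <= x) s -> (j < size s)%N ->
  (c <= nth 0 s j) = (j < count (fun y : R => c <= y)%R s)%N.
Proof.
elim: s j => [|x s IHs] j //= xs js.
have xall : all (fun y => y <= x) s.
  by apply: order_path_min xs => a b d ba ab; exact: le_trans ba.
have s_sorted := path_sorted xs.
have [cx|xc] := leP c x.
  by case: j js => [|j] js; rewrite ?cx ?add1n ?IHs.
have -> : count (fun y : R => c <= y) s = 0%N.
  apply/eqP; rewrite -leqn0 leqNgt -has_count; apply/hasPn => y ys.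
  by rewrite -ltNge (le_lt_trans _ xc) // (allP xall).
case: j js => [|j] js /=; first by rewrite leNgt xc.
by rewrite leNgt (le_lt_trans _ xc) // (allP xall) // mem_nth.
Qed.

Lemma eigval_lipschitz n (M M' : 'M[C]_n) (j : 'I_n) (b : R) :
  ctmx M = M -> ctmx M' = M' -> entry_norm (M - M') < b ->
  eigval j M - b <= eigval j M'.
Proof.
move=> Mh Mh' Mb.
have [s1 _] := eigs_descP Mh; have [s2 _] := eigs_descP Mh'.
rewrite /eigval sorted_nth_ge ?size_eigs_desc //.
(* The thresholds are the eigenvalue itself and the eigenvalue minus [b]; the perturbation bound is
   [entry_norm (M - M')], strictly below [b]. *)
apply: leq_trans (eig_count_mono (c := eigval j M) Mh Mh' _ _).
- by rewrite -sorted_nth_ge ?size_eigs_desc.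
- by rewrite ltrD2l ltrN2; exact: Mb.
- move=> x; rewrite addrC -lerBlDr.
  have -> : qform M x - qform M' x = qform (M - M') x.
    by rewrite /qform mulmxBr mulmxBl [RHS]mxE; congr (_ + _); rewrite [RHS]mxE.
  apply: qform_le_entry_norm.
  by rewrite -[in RHS]Mh -[in RHS]Mh' /ctmx map_mxB linearB.
Qed.

Lemma continuous_eigval (T : topologicalType) n (F : T -> 'M[C]_n) (j : 'I_n)
    (x : T) :
  (forall y, ctmx (F y) = F y) ->
  (forall i k, {for x, continuous (fun y => complex.Re (F y i k))}) ->
  (forall i k, {for x, continuous (fun y => complex.Im (F y i k))}) ->
  {for x, continuous (fun y => eigval j (F y))}.
Proof.
move=> Fh cRe cIm.
have cN : entry_norm (F x - F y) @[y --> x] --> (0 : R).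
  (* Zero is given the shape of the double sum so that limits can be taken term by term. *)
  have -> : (0 : R) = \sum_(i < n) \sum_(k < n) (0 + 0).
    by rewrite big1 // => i _; rewrite big1 // => k _; rewrite addr0.
  apply: cvg_big => [|i _]; first exact: add_continuous.
  apply: cvg_big => [|k _]; first exact: add_continuous.
  apply: cvgD; rewrite -[X in _ --> X](@normr0 R R).
    apply: cvg_norm; rewrite -(subrr (complex.Re (F x i k))).
    rewrite (_ : (fun y => _) =
      fun y => complex.Re (F x i k) - complex.Re (F y i k)).
      by apply: cvgB; [exact: cvg_cst|exact: cRe].
    by apply/funext => y; rewrite !mxE raddfB.
  apply: cvg_norm; rewrite -(subrr (complex.Im (F x i k))).
  rewrite (_ : (fun y => _) =
    fun y => complex.Im (F x i k) - complex.Im (F y i k)).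
    by apply: cvgB; [exact: cvg_cst|exact: cIm].
  by apply/funext => y; rewrite !mxE raddfB.
have entry_normC (A B : 'M[C]_n) : entry_norm (A - B) = entry_norm (B - A).
  apply: eq_bigr => i _; apply: eq_bigr => k _.
  by rewrite -opprB !mxE !raddfN !normrN.
apply/cvgrPdist_le => b b0; move/cvgrPdist_lt/(_ _ b0): cN.
apply: filterS => y; rewrite sub0r normrN => /(le_lt_trans (ler_norm _)) Nb.
rewrite ler_distlC eigval_lipschitz //= -lerBlDr.
by apply: eigval_lipschitz => //; rewrite entry_normC.
Qed.

End EigenvalueContinuity.

(** * Implicit differentiation of a simple root *)

Section ImplicitDerivative.
Variables (R : realType) (V : normedModType R).

Lemma cvg_line (u v : V) : (t *: v + u) @[t --> (0 : R)^'] --> u.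
Proof.
have /(_ 0) cl : continuous (fun t : R => t *: v + u).
  by move=> t; apply: cvgD; [exact: scalel_continuous|exact: cvg_cst].
have := (continuous_withinNx _ _).1 cl.
by rewrite scale0r add0r.
Qed.

Lemma cvg_line_dnbhs (g : V -> R) (u v : V) :
  {for u, continuous g} -> g (t *: v + u) @[t --> (0 : R)^'] --> g u.
Proof. by move=> cg; apply: (continuous_cvg _ cg); exact: cvg_line. Qed.

(* Dividing sum_i c_i eta^i = 0 by t along the line u + t v, after splitting
   off the factor eta(u + t v) - eta(u). *)
Lemma is_derive_root (m : nat) (c : 'I_m -> V -> R) (eta : V -> R) (u v : V) :
  (\forall x \near u, \sum_(i < m) c i x * eta x ^+ i = 0) ->
  {for u, continuous eta} -> (forall i, {for u, continuous (c i)}) ->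
  (forall i, derivable (c i) u v) ->
  \sum_(i < m) c i u * (eta u ^+ i.-1 *+ i) != 0 ->
  is_derive u v eta (- ((\sum_(i < m) 'D_v (c i) u * eta u ^+ i) /
                        (\sum_(i < m) c i u * (eta u ^+ i.-1 *+ i)))).
Proof.
move=> root0 ceta cc dc D0; apply: is_derive_cvg.
(* The inner sum is the cofactor of [eta (t *: v + u) - eta u] in the difference of [i]-th powers.
   Division is only ever by [Q t], so [eta] may take equal values at the two points. *)
pose Q t := \sum_(i < m) c i (t *: v + u) *
  (\sum_(k < i) eta (t *: v + u) ^+ (i.-1 - k) * eta u ^+ k).
pose N t := \sum_(i < m) t^-1 * (c i (t *: v + u) - c i u) * eta u ^+ i.
have cQ : Q t @[t --> (0 : R)^'] -->
    \sum_(i < m) c i u * (eta u ^+ i.-1 *+ i).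
  apply: cvg_big => [|i _]; first exact: add_continuous.
  apply: cvgM; first exact: cvg_line_dnbhs.
  (* For [i = 0] both sides are zero, whatever [i.-1] means there. *)
  have -> : eta u ^+ i.-1 *+ i = \sum_(k < i) eta u ^+ (i.-1 - k) * eta u ^+ k.
    rewrite -[X in _ *+ X]card_ord -sumr_const; apply: eq_bigr => k _.
    by rewrite -exprD subnK // -ltnS (leq_trans (ltn_ord k)) // leqSpred.
  apply: cvg_big => [|k _]; first exact: add_continuous.
  apply: cvgM; last exact: cvg_cst.
  apply: (@continuous_cvg _ _ _ _ _ _ (fun x : R => x ^+ (i.-1 - k))).
    exact: exprn_continuous.
  exact: cvg_line_dnbhs.
have cN : N t @[t --> (0 : R)^'] --> \sum_(i < m) 'D_v (c i) u * eta u ^+ i.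
  apply: cvg_big => [|i _]; first exact: add_continuous.
  by apply: cvgM; [exact: dc|exact: cvg_cst].
have cNQ : - (N t / Q t) @[t --> (0 : R)^'] -->
    - ((\sum_(i < m) 'D_v (c i) u * eta u ^+ i) /
       (\sum_(i < m) c i u * (eta u ^+ i.-1 *+ i))).
  by apply: cvgN; apply: cvgM cN _; exact: cvgV D0 cQ.
apply: cvg_trans cNQ.
apply: near_eq_cvg.
have nQ : \forall t \near ((0 : R)^')%classic, Q t != 0.
  exact: cvgr_neq0 cQ D0.
have nroot : \forall t \near ((0 : R)^')%classic,
    \sum_(i < m) c i (t *: v + u) * eta (t *: v + u) ^+ i = 0.
  exact: cvg_line root0.
near=> t.
have t0 : t != 0 by near: t; exact: nbhs_dnbhs_neq.
have Qt : Q t != 0 by near: t.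
(* The left side telescopes to the difference of the polynomial identities at [t *: v + u] and at
   [u], both of which vanish. *)
have E : (eta (t *: v + u) - eta u) * Q t + t * N t = 0.
  rewrite /Q /N !mulr_sumr -big_split /=.
  transitivity (\sum_(i < m) c i (t *: v + u) * eta (t *: v + u) ^+ i -
     \sum_(i < m) c i u * eta u ^+ i).
    rewrite -sumrB; apply: eq_bigr => i _.
    rewrite mulrCA -subrXX.
    rewrite !mulrA divff // mul1r; ring.
  rewrite (nbhs_singleton root0) subr0; near: t; exact: nroot.
have -> : N t = - (t^-1 * ((eta (t *: v + u) - eta u) * Q t)).
  by rewrite -[X in - (_ * X)](addrK (t * N t)) E sub0r mulrN opprK mulKf.
by rewrite /= mulNr opprK mulrA mulfK.
Unshelve. all: by end_near. Qed.

End ImplicitDerivative.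

(** * Jets of simple eigenvalues *)

Section EigenvalueJets.
Variable R : realType.
Local Notation C := (R[i]).
Local Notation K := (R[i] : numFieldType).

(** The characteristic polynomial of a Hermitian matrix descended to [R], where roots and their
    derivatives can be treated as real functions. *)
Definition real_char_poly n (M : 'M[C]_n) : {poly R} :=
  \prod_(x <- eigs_desc M) ('X - x%:P).

Lemma real_char_polyE n (M : 'M[C]_n) : ctmx M = M ->
  char_poly M = map_poly (real_complex R) (real_char_poly M).
Proof.
move=> Mh; have [_ ->] := eigs_descP Mh.
rewrite rmorph_prod; apply: eq_bigr => x _ /=.
by rewrite rmorphB /= map_polyX map_polyC.
Qed.

Lemma Re_coef_char_poly n (M : 'M[C]_n) i : ctmx M = M ->
  complex.Re (char_poly M)`_i = (real_char_poly M)`_i.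
Proof. by move=> Mh; rewrite real_char_polyE // coef_map. Qed.

Lemma size_real_char_poly n (M : 'M[C]_n) : ctmx M = M ->
  size (real_char_poly M) = n.+1.
Proof. by move=> Mh; rewrite size_prod_XsubC size_eigs_desc. Qed.

Lemma mem_eigval n (M : 'M[C]_n) (j : 'I_n) : ctmx M = M ->
  eigval j M \in eigs_desc M.
Proof. by move=> Mh; rewrite mem_nth // size_eigs_desc. Qed.

Lemma horner_real_char_poly n (M : 'M[C]_n) (x : R) : ctmx M = M ->
  (real_char_poly M).[x] =
  \sum_(i < n.+1) complex.Re (char_poly M)`_i * x ^+ i.
Proof.
move=> Mh; rewrite (horner_coef_wide _ (eq_leq (size_real_char_poly Mh))).
by apply: eq_bigr => i _; rewrite Re_coef_char_poly.
Qed.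

Lemma horner_deriv_real_char_poly n (M : 'M[C]_n) (x : R) : ctmx M = M ->
  (real_char_poly M)^`().[x] =
  \sum_(i < n.+1) complex.Re (char_poly M)`_i * (x ^+ i.-1 *+ i).
Proof.
move=> Mh; rewrite -{1}[real_char_poly M]coefK poly_def size_real_char_poly //.
rewrite raddf_sum horner_sum; apply: eq_bigr => i _ /=.
by rewrite derivZ derivXn hornerZ hornerMn hornerXn Re_coef_char_poly.
Qed.

Lemma root_eigval n (M : 'M[C]_n) (j : 'I_n) : ctmx M = M ->
  (real_char_poly M).[eigval j M] = 0.
Proof.
move=> Mh; apply/eqP; rewrite -/(root _ _) root_prod_XsubC.
exact: mem_eigval.
Qed.

(** At a root, the derivative of the product of linear factors is the product of the remaining
    factors; multiplicity one says that the eigenvalue is not among the remaining roots. *)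
Lemma simple_eig_deriv_neq0 n (M : 'M[C]_n) (j : 'I_n) : ctmx M = M ->
  simple_eig (eigval j M) M -> (real_char_poly M)^`().[eigval j M] != 0.
Proof.
move=> Mh; have [_ ME] := eigs_descP Mh.
rewrite /simple_eig ME.
have -> : \prod_(x <- eigs_desc M) ('X - (x%:C)%C%:P) =
    \prod_(x <- map (real_complex R) (eigs_desc M)) ('X - x%:P).
  by rewrite big_map.
rewrite mu_prod_XsubC (count_map (real_complex R)).
rewrite (eq_count (a2 := pred1 (eigval j M))); last first.
  by move=> x /=; apply/eqP/eqP => [/complexI|->].
have mj := mem_eigval j Mh; move/eqP => c1.
rewrite /real_char_poly (perm_big _ (perm_to_rem mj)) big_cons /=.
rewrite derivM derivXsubC mul1r hornerD [X in _ + X]hornerM hornerXsubC.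
rewrite subrr mul0r addr0 -/(root _ _) root_prod_XsubC.
rewrite -has_pred1 has_count -leqNgt count_rem mj c1.
by rewrite /= eqxx.
Qed.

Local Notation loc_smooth := (@loc_smooth R (R * R)%type 'I_2 (@dir R)).
Local Notation same_jet1 := (@same_jet1 R (R * R)%type 'I_2 (@dir R)).
Local Notation same_jet2 := (@same_jet2 R (R * R)%type 'I_2 (@dir R)).
Local Notation csame_jet2 := (@csame_jet2 R (R * R)%type 'I_2 (@dir R)).

Section EigenvalueFunction.
Variables (n : nat) (M : R * R -> 'M[C]_n) (j : 'I_n) (p : R * R).
Let eta x := eigval j (M x).
Let c (i : 'I_n.+1) x := complex.Re (char_poly (M x))`_i.
(** The derivative of the characteristic polynomial of [M x] at its root [eta x]. *)
Let Dn x := \sum_(i < n.+1) c i x * (eta x ^+ i.-1 *+ i).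
Hypothesis M_herm : forall x, ctmx (M x) = M x.
Hypothesis smooth_Re : forall i k, loc_smooth (fun x => complex.Re (M x i k)) p.
Hypothesis smooth_Im : forall i k, loc_smooth (fun x => complex.Im (M x i k)) p.
Hypothesis smooth_c : forall i, loc_smooth (c i) p.
Hypothesis eta_simple : simple_eig (eta p) (M p).

Lemma near_continuous_eigval : \forall x \near p, {for x, continuous eta}.
Proof.
have nRe : \forall x \near p, forall ik : 'I_n * 'I_n,
    {for x, continuous (fun y => complex.Re (M y ik.1 ik.2))}.
  have n1 (ik : 'I_n * 'I_n) : \forall x \near p,
      {for x, continuous (fun y => complex.Re (M y ik.1 ik.2))}.
    by move: (smooth_Re ik.1 ik.2); apply: filterS => x [].
  exact: filter_forall n1.
have nIm : \forall x \near p, forall ik : 'I_n * 'I_n,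
    {for x, continuous (fun y => complex.Im (M y ik.1 ik.2))}.
  have n1 (ik : 'I_n * 'I_n) : \forall x \near p,
      {for x, continuous (fun y => complex.Im (M y ik.1 ik.2))}.
    by move: (smooth_Im ik.1 ik.2); apply: filterS => x [].
  exact: filter_forall n1.
apply: filterS2 nRe nIm => x cRe cIm; apply: continuous_eigval => // i k.
- exact: cRe (i, k).
- exact: cIm (i, k).
Qed.

Lemma near_smooth_coef : \forall x \near p, forall i,
  {for x, continuous (c i)} /\ forall a, derivable (c i) x (dir R a).
Proof. exact: filter_forall smooth_c. Qed.

Lemma deriv_at_eigval_neq0 : Dn p != 0.
Proof.
by rewrite /Dn -horner_deriv_real_char_poly // simple_eig_deriv_neq0.
Qed.

Lemma near_deriv_at_eigval_neq0 : \forall x \near p, Dn x != 0.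
Proof.
have ceta := nbhs_singleton near_continuous_eigval.
suff cD : Dn x @[x --> p] --> Dn p by exact: cvgr_neq0 cD deriv_at_eigval_neq0.
apply: cvg_big => [|i _]; first exact: add_continuous.
apply: cvgM; first by have [] := nbhs_singleton near_smooth_coef i.
apply: cvgMn.
by apply: (@continuous_cvg _ _ _ _ _ _ (fun x : R => x ^+ i.-1));
  [exact: exprn_continuous|exact: ceta].
Qed.

Lemma near_is_derive_eigval : \forall x \near p, forall a,
  is_derive x (dir R a) eta
    (- ((\sum_(i < n.+1) 'D_(dir R a) (c i) x * eta x ^+ i) / Dn x)).
Proof.
have := near_continuous_eigval; have := near_smooth_coef.
have := near_deriv_at_eigval_neq0.
apply: filterS3 => x D0 cd ceta a.
have root0 : \forall y \near x, \sum_(i < n.+1) c i y * eta y ^+ i = 0.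
  apply: (@filterE _ _ (nbhs_filter x)) => y.
  by rewrite -horner_real_char_poly // root_eigval.
apply: (is_derive_root root0) => //.
- by move=> i; have [] := cd i.
- by move=> i; have [_] := cd i; exact.
Qed.

(** The form with [-1 *] and an explicit inverse lets the jet rules for products and inverses apply
    directly. *)
Lemma near_derive_eigval a : \forall x \near p,
  -1 * ((\sum_(i < n.+1) 'D_(dir R a) (c i) x * eta x ^+ i) * (Dn x)^-1) =
  'D_(dir R a) eta x.
Proof.
apply: filterS near_is_derive_eigval => x /(_ a)[_ ->].
by rewrite mulN1r.
Qed.

Lemma loc_smooth_eigval : loc_smooth eta p.
Proof.
apply: filterS2 near_continuous_eigval near_is_derive_eigval => x cx dx.
by split=> // a; have [] := dx a.
Qed.

End EigenvalueFunction.

Lemma slope_congr m (dc dc' c c' : 'I_m -> R) (x x' : R) :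
  (forall i, dc i = dc' i) -> (forall i, c i = c' i) -> x = x' ->
  -1 * ((\sum_(i < m) dc i * x ^+ i) *
        (\sum_(i < m) c i * (x ^+ i.-1 *+ i))^-1) =
  -1 * ((\sum_(i < m) dc' i * x' ^+ i) *
        (\sum_(i < m) c' i * (x' ^+ i.-1 *+ i))^-1).
Proof. by move=> /funext-> /funext-> ->. Qed.

(** A bootstrap on the implicit formula: evaluated at [p] it equates the first derivatives, so the
    two eigenvalues share a 1-jet; then every ingredient of the formula has matching 1-jets, which
    equates the second derivatives. *)
Lemma same_jet2_eigval n (M M' : R * R -> 'M[C]_n) (j : 'I_n) (p : R * R) :
  (forall x, ctmx (M x) = M x) -> (forall x, ctmx (M' x) = M' x) ->
  (forall i k, csame_jet2 (fun x => M x i k) (fun x => M' x i k) p) ->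
  M p = M' p -> simple_eig (eigval j (M p)) (M p) ->
  same_jet2 (fun x => eigval j (M x)) (fun x => eigval j (M' x)) p.
Proof.
move=> Mh Mh' J MM' simp.
have simp' : simple_eig (eigval j (M' p)) (M' p) by rewrite -MM'.
have Jc (i : 'I_n.+1) := (psame_jet2_char_poly J i).1.
have lc (i : 'I_n.+1) :
    loc_smooth (fun x => complex.Re (char_poly (M x))`_i) p.
  by have [h _ _ _] := Jc i; exact: h.
have lc' (i : 'I_n.+1) :
    loc_smooth (fun x => complex.Re (char_poly (M' x))`_i) p.
  by have [_ h _ _] := Jc i; exact: h.
have lRe i k : loc_smooth (fun x => complex.Re (M x i k)) p.
  by have [[h _ _ _] _] := J i k; exact: h.
have lIm i k : loc_smooth (fun x => complex.Im (M x i k)) p.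
  by have [_ [h _ _ _]] := J i k; exact: h.
have lRe' i k : loc_smooth (fun x => complex.Re (M' x i k)) p.
  by have [[_ h _ _] _] := J i k; exact: h.
have lIm' i k : loc_smooth (fun x => complex.Im (M' x i k)) p.
  by have [_ [_ h _ _]] := J i k; exact: h.
have Dj := near_derive_eigval Mh lRe lIm lc simp.
have Dj' := near_derive_eigval Mh' lRe' lIm' lc' simp'.
have s := loc_smooth_eigval Mh lRe lIm lc simp.
have s' := loc_smooth_eigval Mh' lRe' lIm' lc' simp'.
have Ejet : same_jet1 (fun x => eigval j (M x)) (fun x => eigval j (M' x)) p.
  split; first by rewrite MM'.
  move=> a; have [_ da] := nbhs_singleton s; have [_ da'] := nbhs_singleton s'.
  split; [exact: da|exact: da'|].
  apply: etrans (esym (nbhs_singleton (Dj a))) _.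
  apply: etrans _ (nbhs_singleton (Dj' a)).
  apply: slope_congr => [i|i|].
  - by have [_ _ [_ Ji] _] := Jc i; have [_ _ h] := Ji a; exact: h.
  - by have [_ _ [h _] _] := Jc i; exact: h.
  - exact: congr1 MM'.
split; [exact: s|exact: s'|exact: Ejet|move=> b].
apply: (same_jet1_near (Dj b) (Dj' b)).
apply: same_jet1M; first exact: same_jet1_cst.
apply: same_jet1M.
  apply: same_jet1_sum => i; apply: same_jet1M; last exact: same_jet1X.
  by have [_ _ _ h] := Jc i; exact: h.
apply: same_jet1V; first exact: deriv_at_eigval_neq0.
apply: same_jet1_sum => i; apply: same_jet1M.
  by have [_ _ h _] := Jc i; exact: h.
(* The multiple [*+ i] becomes a product with the constant [i%:R], to which the product rule
   applies. *)
apply: (same_jet1_ext (f := fun x => i%:R * eigval j (M x) ^+ i.-1)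
    (g := fun x => i%:R * eigval j (M' x) ^+ i.-1)).
- by move=> x; rewrite mulr_natl.
- by move=> x; rewrite mulr_natl.
- by apply: same_jet1M; [exact: same_jet1_cst|exact: same_jet1X].
Qed.

Lemma same_jet2_grad_hess (g h : R * R -> R) p :
  same_jet2 g h p -> same_grad_hess g h p.
Proof.
move=> [_ _ [_ J1] J2] a b; split; first exact: J1.
by have [_] := J2 b; exact.
Qed.

Lemma eta_fun_same_grad_hess n (F G : K -> 'M[K]_n) (N N' : 'M[{poly K}]_n)
    (D D' : {poly K}) (s : K) (j : 'I_n) :
  D.[s] != 0 -> D'.[s] != 0 ->
  (forall t, D.[t] != 0 -> F t = ratmx N D t) ->
  (forall t, D'.[t] != 0 -> G t = ratmx N' D' t) ->
  F s = G s -> derive1n 1 F s = derive1n 1 G s ->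
  derive1n 2 F s = derive1n 2 G s ->
  simple_eig (eigval j (Mof F s)) (Mof F s) ->
  same_grad_hess (eta_fun j F) (eta_fun j G) (cplx_pt s).
Proof.
have sE : pt_cplx (cplx_pt s) = s by case: (s).
move=> Ds Ds' FE GE E0 E1 E2 simp; apply: same_jet2_grad_hess.
have J := @csame_jet2_ratmx _ _ F G N N' D D' (cplx_pt s).
rewrite /= sE in J; have {}J := J Ds Ds' FE GE E0 E1 E2.
apply: (@same_jet2_eigval _ (fun x => Mof F (pt_cplx x))
  (fun x => Mof G (pt_cplx x))).
- by move=> x; exact: ctmx_Mof.
- by move=> x; exact: ctmx_Mof.
- exact: csame_jet2_Mof J.
- by rewrite sE /Mof E0.
- by rewrite sE.
Qed.

End EigenvalueJets.

(** * The full and the reduced function at the interpolation points *)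

Theorem theorem2p2 (R : realType) (n k d r q l : nat)
    (P : 'I_d.+1 -> 'M[R[i]]_n) (A : 'M[R[i]]_k) (B : 'M[R[i]]_(k, n))
    (Cm : 'M[R[i]]_(n, k)) (W V : 'M[R[i]]_(k, r)) (lam : 'I_l -> R[i]) :
  (2 <= q)%N ->
  ctmx W *m W = 1%:M -> ctmx V *m V = 1%:M ->
  (forall t : 'I_l, (lam t)%:M - A \in unitmx) ->
  (forall t : 'I_l,
     lam t *: (ctmx W *m V) - ctmx W *m A *m V \in unitmx) ->
  (forall t : 'I_l, Rfun P A B Cm (lam t) = Rred P A B Cm W V (lam t)) ->
  (forall (t : 'I_l) (j : nat), (1 <= j <= 2 * q - 1)%N ->
     derive1n j (Rfun P A B Cm) (lam t) =
     derive1n j (Rred P A B Cm W V) (lam t)) ->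
  forall (t : 'I_l) (j : 'I_n),
    eigval j (Mof (Rfun P A B Cm) (lam t)) =
      eigval j (Mof (Rred P A B Cm W V) (lam t)) /\
    (simple_eig (eigval j (Mof (Rfun P A B Cm) (lam t)))
                (Mof (Rfun P A B Cm) (lam t)) ->
     simple_eig (eigval j (Mof (Rred P A B Cm W V) (lam t)))
                (Mof (Rred P A B Cm W V) (lam t)) /\
     same_grad_hess (eta_fun j (Rfun P A B Cm))
                    (eta_fun j (Rred P A B Cm W V)) (cplx_pt (lam t))).
Proof.
move=> q2 _ _ uA uWV E0 Ej t j.
have ME : Mof (Rfun P A B Cm) (lam t) = Mof (Rred P A B Cm W V) (lam t).
  by rewrite /Mof E0.
split=> [|simp]; first by rewrite ME.
split; first by rewrite -ME.
(* The pencils are [s - A] for the full function and [s W^* V - W^* A V] for the reduced one; their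
   invertibility at [lam t] makes the two denominators nonzero there. *)
have [N [D [DE FE]]] := resolvent_ratmx P A 1%:M B Cm.
have [N' [D' [DE' GE]]] := resolvent_ratmx P (ctmx W *m A *m V)
  (ctmx W *m V) (ctmx W *m B) (Cm *m V).
have Ds : D.[lam t] != 0 by rewrite DE scalemx1 -unitfE -unitmxE.
have Ds' : D'.[lam t] != 0 by rewrite DE' -unitfE -unitmxE.
have FE1 s : D.[s] != 0 -> Rfun P A B Cm s = ratmx N D s.
  by move=> /FE <-; rewrite scalemx1.
have GE1 s : D'.[s] != 0 -> Rred P A B Cm W V s = ratmx N' D' s.
  by move=> /GE <-.
have E1 := Ej t 1%N; have E2 := Ej t 2%N.
(* Since [2 <= q], the interpolation orders reach at least 3, which covers the first and second
   derivatives. *)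
have q1 : (1 <= 1 <= 2 * q - 1)%N by rewrite /=; lia.
have q2' : (1 <= 2 <= 2 * q - 1)%N by rewrite /=; lia.
exact: (eta_fun_same_grad_hess Ds Ds' FE1 GE1 (E0 t) (E1 q1) (E2 q2') simp).
Qed.
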